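(* Let $S$ be a Polish space and let $\Gamma\subset C_b(S)$ be an admissible set. Then for every $\mu\in\mathcal{M}(S)$ and every $\nu\in\mathcal{P}(S)$, $$G_{\Gamma}(\mu\Vert\nu)=\inf_{\gamma\in\mathcal{P}(S)}\left\{R(\gamma\Vert\nu)+W_{\Gamma}(\mu-\gamma)\right\}.$$
   Context: $S$ is a Polish space with its Borel $\sigma$-algebra. $\mathcal{P}(S)$ is the set of Borel probability measures on $S$, $\mathcal{M}(S)$ the space of finite signed Borel measures on $S$, and $C_b(S)$ the space of bounded continuous functions $S\to\mathbb{R}$. $C_b(S)$ carries the weak topology induced by $\mathcal{M}(S)$, i.e. the coarsest topology making $g\mapsto\int_S g\,d\mu$ continuous for every $\mu\in\mathcal{M}(S)$. A set $\Gamma\subset C_b(S)$ is called admissible if: (1) $\Gamma$ is convex and closed (in the weak topology on $C_b(S)$ induced by $\mathcal{M}(S)$); (2) $\Gamma$ is symmetric ($g\in\Gamma$ implies $-g\in\Gamma$) and contains all constant functions; (3) $\Gamma$ is determining for $\mathcal{P}(S)$: for all $\mu,\nu\in\mathcal{P}(S)$ with $\mu\ne\nu$ there is $g\in\Gamma$ with $\int_S g\,d\mu\neq\int_S g\,d\nu$. For $\gamma,\nu\in\mathcal{P}(S)$, $R(\gamma\Vert\nu)=\int_S\log\frac{d\gamma}{d\nu}\,d\gamma$ if $\gamma\ll\nu$, and $R(\gamma\Vert\nu)=\infty$ otherwise (relative entropy). For $\mu\in\mathcal{M}(S)$, $\nu\in\mathcal{P}(S)$, the $\Gamma$-divergence is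 $G_\Gamma(\mu\Vert\nu)=\sup_{g\in\Gamma}\{\int_S g\,d\mu-\log\int_S e^g\,d\nu\}$. For $\eta\in\mathcal{M}(S)$, $W_\Gamma(\eta)=\sup_{g\in\Gamma}\int_S g\,d\eta$. All of these may take the value $+\infty$. *)

(* Defs.v *)
From HB Require Import structures.
From mathcomp Require Import all_boot all_order all_algebra.
From mathcomp Require Import all_classical all_reals all_analysis.

Set Implicit Arguments.
Unset Strict Implicit.
Unset Printing Implicit Defensive.

Import Order.TTheory GRing.Theory Num.Theory.
Import numFieldNormedType.Exports.

Local Open Scope classical_set_scope.
Local Open Scope ring_scope.

Definition separable (S : topologicalType) :=
  exists2 D : set S, countable D & dense D.

(* [M] is a metric structure on the carrier of [S]; the metric topology is
   required to be the given one. *)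
Definition completely_metrizable (R : realType) (S : topologicalType) :=
  exists M : Metric R S, let T : metricType R := Metric.Pack M in
    (@open T = @open S :> set (set S)) /\
    (forall F : set_system T, ProperFilter F -> cauchy F ->
       exists l : T, F --> l).

Definition polish (R : realType) (S : topologicalType) :=
  separable S /\ completely_metrizable R S.

(* [g_sigma_algebraType] needs a pointed carrier; this is harmless below since
   a space carrying a probability measure is nonempty. *)
Notation borel S := (g_sigma_algebraType (@open S)).

(* Borel probability measures are elements of [probability (borel S) R] and
   finite signed Borel measures are elements of
   [{charge set (borel S) -> \bar R}].  Both are total functions on [set S]
   that are only constrained on Borel sets, so measures are compared on Borel
   sets and not with [=]. *)

(* Integral against a signed measure, through its Jordan decomposition. The
   Hahn decomposition is picked by choice; it is unique up to null sets, so the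
   value does not depend on it. *)
Definition charge_integral d (T : measurableType d) (R : realType)
    (mu : {charge set T -> \bar R}) (f : T -> R) : R :=
  let muP := cid (Hahn_decomposition mu) in
  let muPN := cid (svalP muP) in
  \int[jordan_pos (svalP muPN)]_x f x - \int[jordan_neg (svalP muPN)]_x f x.

Section Cb.
Context (R : realType) (S : ptopologicalType).

Definition bounded_continuous : {pred S -> R} :=
  mem [set f : S -> R | continuous f /\ bounded_fun f].

Lemma bounded_continuousP (f : S -> R) :
  reflect (continuous f /\ bounded_fun f) (f \in bounded_continuous).
Proof. by apply: (iffP idP); rewrite !inE. Qed.

Lemma bounded_continuous_submod_closed : submod_closed bounded_continuous.
Proof.
split=> [|a f g /bounded_continuousP[cf bf] /bounded_continuousP[cg bg]];
    apply/bounded_continuousP.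
  split; first exact: cst_continuous.
  exact: bounded_cst.
split; first by move=> x; apply: cvgD; [apply: cvgZl_tmp; exact: cf|exact: cg].
have [M [_ fM]] := bf; have [N [_ gN]] := bg.
exists (`|a| * (`|M| + 1) + (`|N| + 1)); split; first exact: num_real.
move=> K /ltW leK x _; apply: le_trans leK => /=.
rewrite (le_trans (ler_normD _ _))// lerD//; last first.
  by apply: gN => //; rewrite (le_lt_trans (ler_norm _))// ltrDl.
rewrite normrZ ler_wpM2l//.
by apply: fM => //; rewrite (le_lt_trans (ler_norm _))// ltrDl.
Qed.

HB.instance Definition _ := GRing.isSubmodClosed.Build R (S -> R)
  bounded_continuous bounded_continuous_submod_closed.

Record Cb := MkCb { Cb_val :> S -> R; _ : Cb_val \in bounded_continuous }.

HB.instance Definition _ := [isSub for Cb_val].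
HB.instance Definition _ := [Choice of Cb by <:].
HB.instance Definition _ := [SubChoice_isSubLmodule of Cb by <:].

Lemma cst_bounded_continuous (c : R) : cst c \in bounded_continuous.
Proof.
by apply/bounded_continuousP; split; [exact: cst_continuous|exact: bounded_cst].
Qed.

Definition Cb_cst (c : R) : Cb := MkCb (cst_bounded_continuous c).

(* [Cb] with the coarsest topology making all the maps
   [g |-> \int g dmu] continuous, [mu] a finite signed Borel measure. *)
Definition weak_Cb : Type := Cb.

HB.instance Definition _ := Topological.copy weak_Cb
  (sup_topology (fun mu : {charge set (borel S) -> \bar R} =>
     Topological.class (initial_topology
       (fun g : Cb => charge_integral mu g : R)))).

End Cb.

Section gamma_divergence.
Local Open Scope charge_scope.
Context (R : realType) (S : ptopologicalType).
Implicit Type Gamma : set (Cb R S).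

Definition determining Gamma := forall mu nu : probability (borel S) R,
  ~ (forall A, measurable A -> mu A = nu A) ->
  exists2 g, Gamma g & \int[mu]_x g x != \int[nu]_x g x.

Definition admissible Gamma :=
  [/\ convex_set (Gamma : set (convex_lmodType (Cb R S))),
      closed (Gamma : set (weak_Cb R S)),
      (forall g, Gamma g -> Gamma (- g)),
      (forall c, Gamma (Cb_cst S c)) &
      determining Gamma].

(* [lne 0 = -oo]; since t * log t is bounded below, the negative part of the
   integrand is always [gamma]-integrable and no [+oo - oo] arises. *)
Definition relative_entropy (gamma nu : probability (borel S) R) : \bar R :=
  if `[< gamma `<< nu >] then
    (\int[gamma]_x lne (('d (charge_of_finite_measure gamma) '/d nu) x))%E
  else +oo%E.

Definition Gamma_divergence Gamma (mu : {charge set (borel S) -> \bar R})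
    (nu : probability (borel S) R) : \bar R :=
  ereal_sup [set (charge_integral mu g - ln (\int[nu]_x expR (g x)))%:E
            | g in Gamma].

Definition W_Gamma Gamma (eta : {charge set (borel S) -> \bar R}) : \bar R :=
  ereal_sup [set (charge_integral eta g)%:E | g in Gamma].

Definition charge_sub (mu : {charge set (borel S) -> \bar R})
    (gamma : probability (borel S) R) : {charge set (borel S) -> \bar R} :=
  cadd mu (copp (charge_of_finite_measure gamma)).

End gamma_divergence.

(* Main.v *)
From HB Require Import structures.
Require Import Defs.
From mathcomp Require Import all_boot all_order all_algebra.
From mathcomp Require Import all_classical all_reals all_analysis.
From mathcomp Require Import measurable_realfun.
From mathcomp Require Import ring lra.

(** Why the theorem holds.

    Write [H f] for the cumulant [ln (\int[nu]_x expR (f x))].  One inequality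
    is the easy half of the Donsker-Varadhan formula: for [g] in [Gamma],
    [\int g dmu - H g] is the sum of [\int g dgamma - H g], which is at most
    [R(gamma || nu)] (lemma [cumulant_le_entropy]), and of
    [\int g d(mu - gamma)], which is at most [W_Gamma (mu - gamma)].

    For the other inequality an optimal [gamma] is produced by convex duality.
    Let [m] be the Gamma-divergence, assumed finite.  Then the affine function
    [g |-> \int g dmu - m] lies below the convex function [H] on the convex set
    [Gamma], and the sandwich theorem ([convex_sandwich], a form of Hahn-Banach)
    gives a linear [L] and a constant [c] with [L + c <= H] everywhere and
    [\int g dmu - m <= L g + c] on [Gamma].

    The duality is carried out in the space of all bounded Borel functions, on
    which [H] is still finite and convex, and not in the space of bounded
    continuous functions.  Then [L] has values on indicators, and
    [L + c <= H] alone forces [A |-> L \1_A] to be a probability measure [gamma]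
    with [gamma << nu] whose integral is [L] ([cumulant_minorant_integral]).
    The point is countable additivity: for [0 <= r <= 1],
    [t * L r + c <= H (t r) <= (expR t - 1) * \int[nu] r], so that [L r] is
    small as soon as [\int[nu] r] is: take [t] large first.

    Finally [\int f dgamma + c <= H f] for all bounded Borel [f] gives
    [R(gamma || nu) <= - c] by the other half of Donsker-Varadhan
    ([entropy_le]), where bounded Borel approximations of the logarithm of the
    density are legitimate test functions; and the second property of [L] reads
    [W_Gamma (mu - gamma) <= m + c].  The two bounds add up to [m]. *)

Set Implicit Arguments.
Unset Strict Implicit.
Unset Printing Implicit Defensive.

Import Order.TTheory GRing.Theory Num.Theory.
Import numFieldNormedType.Exports.

Local Open Scope classical_set_scope.
Local Open Scope ring_scope.

(** * Hahn-Banach theorem and convex sandwich theorem *)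

Section hahn_banach.
Context (R : realType) (V : lmodType R).
Implicit Types (p q : V -> R).

Definition sublinear p :=
  (forall (a : R) x, 0 < a -> p (a *: x) = a * p x) /\
  (forall x y, p (x + y) <= p x + p y).

(** The reverse inequality is the same one for [a^-1] at [a *: x]. *)
Lemma homogeneous_of_le p :
  (forall (a : R) x, 0 < a -> p (a *: x) <= a * p x) ->
  forall (a : R) x, 0 < a -> p (a *: x) = a * p x.
Proof.
move=> ple a x a0; apply/le_anti; rewrite ple//=.
have ai0 : 0 < a^-1 by rewrite invr_gt0.
have := ple _ (a *: x) ai0; rewrite scalerA mulVf ?gt_eqF// scale1r.
by rewrite mulrC ler_pdivlMr// mulrC.
Qed.

Lemma sublinear0 p : sublinear p -> p 0 = 0.
Proof. by move=> [/(_ 2 0) + _]; rewrite scaler0; lra. Qed.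

Lemma sublinear_geN p x : sublinear p -> - p (- x) <= p x.
Proof.
by move=> sp; have := sp.2 x (- x); rewrite subrr (sublinear0 sp); lra.
Qed.

(** A functional that cannot be lowered is additive: for fixed [y], the
    infimum over [0 <= t] of [p (x + t *: y) - t * p y] is sublinear in [x] and
    below [p], hence equal to [p], and its value is at most the term [t = 1]. *)
Lemma minimal_sublinear_additive p : sublinear p ->
  (forall q, sublinear q -> (forall x, q x <= p x) -> forall x, p x <= q x) ->
  forall x y, p (x + y) = p x + p y.
Proof.
move=> sp minp x y; apply/le_anti; rewrite sp.2/=.
pose E x := [set p (x + t *: y) - t * p y | t in [set t : R | 0 <= t]].
have pscale t z : 0 <= t -> p (t *: z) = t * p z.
  rewrite le_eqVlt => /predU1P[<-|]; last exact: sp.1.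
  by rewrite scale0r mul0r sublinear0.
have lbE z : lbound (E z) (- p (- z)).
  move=> _ [t /= t0 <-].
  by have := sp.2 (z + t *: y) (- z); rewrite addrAC subrr add0r pscale//; lra.
have E0 z : E z !=set0 by exists (p (z + 0 *: y) - 0 * p y), 0 => /=.
have infE z : has_inf (E z) by split=> //; exists (- p (- z)).
have leE z t : 0 <= t -> inf (E z) <= p (z + t *: y) - t * p y.
  by move=> t0; apply: ge_inf; [exact: (infE z).2|exists t].
have sq : sublinear (fun z => inf (E z)).
  split=> [|u v] /=.
    apply: homogeneous_of_le => a z a0.
    rewrite mulrC -ler_pdivrMr//; apply: lb_le_inf => // _ [t /= t0 <-].
    rewrite ler_pdivrMr// (le_trans (leE _ _ (mulr_ge0 (ltW a0) t0)))//.
    by rewrite -scalerA -scalerDr sp.1//; lra.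
  rewrite -lerBlDr; apply: lb_le_inf => // _ [t /= t0 <-].
  rewrite lerBlDr [leRHS]addrC -lerBlDr; apply: lb_le_inf => // _ [s /= s0 <-].
  rewrite lerBlDr (le_trans (leE _ _ (addr_ge0 s0 t0)))//.
  have := sp.2 (v + s *: y) (u + t *: y).
  by rewrite addrACA -scalerDl [v + u]addrC; lra.
have := minp _ sq; rewrite /= => /(_ _ x) pq.
have {}pq : p x <= inf (E x).
  apply: pq => z; have := leE z 0 (lexx _).
  by rewrite scale0r addr0 mul0r subr0.
by have := leE x 1 ler01; rewrite scale1r mul1r; lra.
Qed.

(** Hahn-Banach: Zorn's lemma gives a minimal sublinear functional below [p],
    the infimum of a chain being sublinear because [q x >= - p (- x)] bounds it
    from below. *)
Lemma sublinear_ge_linear p : sublinear p ->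
  exists L : {scalar V}, forall x, L x <= p x.
Proof.
move=> sp.
pose T := {q : V -> R | sublinear q /\ forall x, q x <= p x}.
pose le (q r : T) := `[< forall x, sval r x <= sval q x >].
have lbT (q : T) x : - p (- x) <= sval q x.
  case: q => q [sq qp]/=; rewrite (le_trans _ (sublinear_geN _ sq))//.
  by rewrite lerN2.
have pT : sublinear p /\ forall x, p x <= p x by [].
have [|||q minq] := @ZL_preorder T (exist _ p pT) le.
- by move=> q; apply/asboolP.
- move=> q r s /asboolP qr /asboolP rs; apply/asboolP => x.
  exact: le_trans (qr x).
- move=> A totA; have [[q0 Aq0]|] := pselect (A !=set0); last first.
    move=> /set0P/negP; rewrite negbK => /eqP ->.
    by exists (exist _ p pT).
  pose E x := [set sval q x | q in A].
  have infE x : has_inf (E x).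
    split; first by exists (sval q0 x), q0.
    by exists (- p (- x)) => _ [q _ <-]; exact: lbT.
  have leE x (q : T) : A q -> inf (E x) <= sval q x.
    by move=> Aq; apply: ge_inf; [exact: (infE x).2|exists q].
  have si : sublinear (fun x => inf (E x)) /\ forall x, inf (E x) <= p x.
    split; last first.
      by move=> x; rewrite (le_trans (leE x _ Aq0))//; exact: (svalP q0).2.
    split=> [|x y] /=.
      apply: homogeneous_of_le => a x a0; rewrite mulrC -ler_pdivrMr//.
      apply: lb_le_inf; first exact: (infE x).1.
      move=> _ [q Aq <-]; rewrite ler_pdivrMr// mulrC.
      by rewrite -(svalP q).1.1//; exact: leE.
    rewrite -lerBlDr; apply: lb_le_inf; first exact: (infE x).1.
    move=> _ [q Aq <-]; rewrite lerBlDr [leRHS]addrC -lerBlDr.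
    apply: lb_le_inf; first exact: (infE y).1.
    move=> _ [r Ar <-]; rewrite lerBlDr.
    have [/asboolP qr|/asboolP rq] := totA _ _ Aq Ar.
      rewrite (le_trans (leE _ _ Ar))// (le_trans ((svalP r).1.2 _ _))//.
      by rewrite addrC lerD2l.
    rewrite (le_trans (leE _ _ Aq))// (le_trans ((svalP q).1.2 _ _))//.
    by rewrite addrC lerD2r.
  exists (exist _ (fun x => inf (E x)) si) => q Aq.
  by apply/asboolP => x; exact: leE.
have [sq qp] := svalP q.
have qD : forall x y, sval q (x + y) = sval q x + sval q y.
  apply: (minimal_sublinear_additive sq) => r sr rq.
  have rT : sublinear r /\ forall x, r x <= p x.
    by split=> // x; exact: le_trans (rq x) (qp x).
  by apply/asboolP; apply: (minq (exist _ r rT)); exact/asboolP.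
have qN x : sval q (- x) = - sval q x.
  by have := qD x (- x); rewrite subrr (sublinear0 sq); lra.
have qlin : scalar (sval q).
  move=> a x y; rewrite qD; congr (_ + _).
  have [a0|a0|<-] := ltgtP 0 a; first exact: sq.1.
    by rewrite -[a]opprK scaleNr qN sq.1 ?oppr_gt0//= !mulNr opprK.
  by rewrite scale0r (sublinear0 sq)/= mul0r.
pose L : {scalar V} := HB.pack (sval q) (GRing.isLinear.Build _ _ _ _ _ qlin).
by exists L.
Qed.

End hahn_banach.

Section sandwich.
Context (R : realType) (V : lmodType R).

Definition convex_fun (A : set V) (f : V -> R) :=
  forall x y (s t : R), A x -> A y -> 0 <= s -> 0 <= t -> s + t = 1 ->
    f (s *: x + t *: y) <= s * f x + t * f y.

(** The sublinear functional is the infimum over [0 < t] of [F (t *: x) / t];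
    convexity and [0 <= F 0] bound it from below by [- F (- x)]. *)
Lemma convex_ge_linear (F : V -> R) : convex_fun setT F -> 0 <= F 0 ->
  exists L : {scalar V}, forall x, L x <= F x.
Proof.
move=> cF F0.
pose E x := [set F (t *: x) / t | t in [set t : R | 0 < t]].
have lbE x : lbound (E x) (- F (- x)).
  move=> _ [t /= t0 <-].
  (* [0] is a convex combination of [t *: x] and [- x] *)
  have t1 : 0 < 1 + t by rewrite addr_gt0.
  have u0 : 0 <= (1 + t)^-1 by rewrite invr_ge0 ltW.
  have w0 : 0 <= t / (1 + t) by rewrite mulr_ge0// ltW.
  have uw : (1 + t)^-1 + t / (1 + t) = 1.
    by rewrite -[X in X + _]mul1r -mulrDl divff ?gt_eqF.
  have := cF (t *: x) (- x) _ _ I I u0 w0 uw.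
  rewrite scalerN scalerA [_^-1 * t]mulrC subrr.
  move=> /(le_trans F0).
  have -> : (1 + t)^-1 * F (t *: x) + t / (1 + t) * F (- x) =
            (F (t *: x) + t * F (- x)) / (1 + t) by rewrite mulrDl; ring.
  by rewrite pmulr_lge0 ?invr_gt0// ler_pdivlMr//; lra.
have infE x : has_inf (E x).
  split; last by exists (- F (- x)).
  by exists (F (1 *: x) / 1), 1 => /=.
have leE x t : 0 < t -> inf (E x) <= F (t *: x) / t.
  by move=> t0; apply: ge_inf; [exact: (infE x).2|exists t].
pose p x := inf (E x).
have sp : sublinear p.
  split=> [|x y] /=.
    apply: homogeneous_of_le => a x a0.
    rewrite mulrC -ler_pdivrMr//; apply: lb_le_inf; first exact: (infE x).1.
    move=> _ [t /= t0 <-].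
    have ta0 : 0 < t / a by rewrite divr_gt0.
    rewrite ler_pdivrMr// (le_trans (leE _ _ ta0))//.
    by rewrite scalerA divfK ?gt_eqF// invf_div mulrA mulrAC.
  rewrite -lerBlDr; apply: lb_le_inf; first exact: (infE x).1.
  move=> _ [s /= s0 <-]; rewrite lerBlDr [leRHS]addrC -lerBlDr.
  apply: lb_le_inf; first exact: (infE y).1.
  move=> _ [t /= t0 <-]; rewrite lerBlDr.
  have st0 : 0 < s + t by rewrite addr_gt0.
  (* [r *: (x + y)] is a convex combination of [s *: x] and [t *: y] exactly for
     [r = s t / (s + t)] *)
  have r0 : 0 < s * t / (s + t) by rewrite divr_gt0// mulr_gt0.
  rewrite (le_trans (leE _ _ r0))// ler_pdivrMr//.
  have u0 : 0 <= t / (s + t) by rewrite divr_ge0// ltW.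
  have w0 : 0 <= s / (s + t) by rewrite divr_ge0// ltW.
  have uw : t / (s + t) + s / (s + t) = 1.
    by rewrite -mulrDl [t + s]addrC divff ?gt_eqF.
  have := cF (s *: x) (t *: y) _ _ I I u0 w0 uw; rewrite !scalerA.
  rewrite [_ / _ * s]mulrC mulrA [_ / _ * t]mulrC mulrA [t * s]mulrC -scalerDr.
  move=> /le_trans; apply.
  rewrite le_eqVlt; apply/orP; left; apply/eqP; field.
  by rewrite !gt_eqF.
have [L Lp] := sublinear_ge_linear sp; exists L => x.
by rewrite (le_trans (Lp x))// (le_trans (leE _ _ ltr01))// scale1r divr1.
Qed.

(** Sandwich theorem: the infimum over [g] in [A] of [H (v + g) - l g + m] is a
    convex function of [v], nonnegative at [0], so that it dominates a linear
    [L]; this says that the infimum of [H - L] is at least the supremum of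
    [l - m - L] over [A], and [c] is the former. *)
Lemma convex_sandwich (A : set V) (l : {scalar V}) (m : R) (H : V -> R) :
  A !=set0 ->
  (forall x y (s t : R), A x -> A y -> 0 <= s -> 0 <= t -> s + t = 1 ->
     A (s *: x + t *: y)) ->
  convex_fun setT H -> (forall g, A g -> l g - m <= H g) ->
  exists (L : {scalar V}) (c : R),
    (forall v, L v + c <= H v) /\ (forall g, A g -> l g - m <= L g + c).
Proof.
move=> [g0 Ag0] cA cH lH.
pose E v := [set H (v + g) - l g + m | g in A].
(* convexity at the midpoint of [v + g] and [- v + g0], a point of [A] *)
have lbE v : lbound (E v) (- (H (- v + g0) - l g0 + m)).
  move=> _ [g Ag <-].
  have h0 : 0 <= 2^-1 :> R by rewrite invr_ge0.
  have hh : 2^-1 + 2^-1 = 1 :> R by lra.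
  have := lH _ (cA _ _ _ _ Ag Ag0 h0 h0 hh).
  have := cH (v + g) (- v + g0) _ _ I I h0 h0 hh.
  have -> : 2^-1 *: (v + g) + 2^-1 *: (- v + g0) = 2^-1 *: g + 2^-1 *: g0.
    by rewrite -!scalerDr addrACA subrr add0r.
  by rewrite linearD/= !linearZ/=; lra.
have infE v : has_inf (E v).
  split; first by exists (H (v + g0) - l g0 + m), g0.
  by exists (- (H (- v + g0) - l g0 + m)); exact: lbE.
have leE v g : A g -> inf (E v) <= H (v + g) - l g + m.
  by move=> Ag; apply: ge_inf; [exact: (infE v).2|exists g].
have cF : convex_fun setT (fun v => inf (E v)).
  move=> x y s t _ _ /=; rewrite le_eqVlt => /predU1P[<-|s0].
    by move=> _; rewrite !add0r => ->; rewrite !scale0r !mul0r !add0r scale1r mul1r.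
  rewrite le_eqVlt => /predU1P[<-|t0 st].
    by rewrite !addr0 => ->; rewrite !scale0r !mul0r !addr0 scale1r mul1r.
  rewrite -lerBlDr [leRHS]mulrC -ler_pdivrMr//.
  apply: lb_le_inf; first exact: (infE x).1.
  move=> _ [g Ag <-]; rewrite ler_pdivrMr// lerBlDr [leRHS]addrC -lerBlDr.
  rewrite [leRHS]mulrC -ler_pdivrMr//; apply: lb_le_inf; first exact: (infE y).1.
  move=> _ [h Ah <-]; rewrite ler_pdivrMr// lerBlDr.
  have := leE (s *: x + t *: y) _ (cA _ _ _ _ Ag Ah (ltW s0) (ltW t0) st).
  rewrite addrACA -!scalerDr => /le_trans; apply.
  have := cH (x + g) (y + h) _ _ I I (ltW s0) (ltW t0) st.
  rewrite [l (_ + _)]linearD ![l (_ *: _)]linearZ/=.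
  have : s * m + t * m = m by rewrite -mulrDl st mul1r.
  by lra.
have F0 : 0 <= inf (E 0).
  apply: lb_le_inf; first exact: (infE 0).1.
  by move=> _ [g Ag <-]; have := lH _ Ag; rewrite add0r; lra.
have [L LF] := convex_ge_linear cF F0.
have LH v g : A g -> l g - m - L g <= H v - L v.
  move=> Ag; have := le_trans (LF (v - g)) (leE (v - g) _ Ag).
  by rewrite subrK linearB/=; lra.
pose D := [set H v - L v | v in [set: V]].
have infD : has_inf D.
  split; first by exists (H 0 - L 0), 0.
  by exists (l g0 - m - L g0) => _ [v _ <-]; exact: LH.
exists L, (inf D); split=> [v|g Ag].
  have : inf D <= H v - L v by apply: ge_inf; [exact: infD.2|exists v].
  by lra.
have : l g - m - L g <= inf D.
  by apply: lb_le_inf; [exact: infD.1|move=> _ [v _ <-]; exact: LH].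
by lra.
Qed.

End sandwich.

(** * Bounded measurable functions *)

Section bounded_measurable.
Context d (T : measurableType d) (R : realType).
Implicit Types (f g : T -> R).

Definition bounded_measurable : {pred T -> R} :=
  mem [set f : T -> R | measurable_fun setT f /\ exists M, forall x, `|f x| <= M].

Lemma bounded_measurableP f :
  reflect (measurable_fun setT f /\ exists M, forall x, `|f x| <= M)
          (f \in bounded_measurable).
Proof. by apply: (iffP idP); rewrite !inE. Qed.

Lemma bounded_measurable_submod_closed : submod_closed bounded_measurable.
Proof.
split=> [|a f g /bounded_measurableP[mf [M fM]] /bounded_measurableP[mg [N gN]]];
    apply/bounded_measurableP.
  by split; [exact: measurable_cst|exists 0 => x; rewrite normr0].
split.
  by apply: measurable_funD => //; exact: measurable_funM.
exists (`|a| * M + N) => x; rewrite (le_trans (ler_normD _ _))// lerD//.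
by rewrite normrM ler_wpM2l.
Qed.

HB.instance Definition _ := GRing.isSubmodClosed.Build R (T -> R)
  bounded_measurable bounded_measurable_submod_closed.

Record bmfun := BMFun { bmfun_val :> T -> R; _ : bmfun_val \in bounded_measurable }.

HB.instance Definition _ := [isSub for bmfun_val].
HB.instance Definition _ := [Choice of bmfun by <:].
HB.instance Definition _ := [SubChoice_isSubLmodule of bmfun by <:].

Lemma measurable_bmfun (f : bmfun) : measurable_fun setT f.
Proof. by have /bounded_measurableP[] := valP f. Qed.

Lemma bounded_bmfun (f : bmfun) : exists M, forall x, `|f x| <= M.
Proof. by have /bounded_measurableP[] := valP f. Qed.

Lemma bmfunD (f g : bmfun) x : (f + g) x = f x + g x.
Proof. by rewrite -[bmfun_val (f + g)]/(val (f + g)) raddfD. Qed.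

Lemma bmfunZ (a : R) (f : bmfun) x : (a *: f) x = a * f x.
Proof. by rewrite -[bmfun_val (a *: f)]/(val (a *: f)) linearZ. Qed.

Lemma bmfunN (f : bmfun) x : (- f) x = - f x.
Proof. by rewrite -[bmfun_val (- f)]/(val (- f)) raddfN. Qed.

Lemma bmfunB (f g : bmfun) x : (f - g) x = f x - g x.
Proof. by rewrite bmfunD bmfunN. Qed.

Lemma bmfun0 x : (0 : bmfun) x = 0.
Proof. by rewrite -[bmfun_val 0]/(val (0 : bmfun)) raddf0. Qed.

Lemma bmfun_sum (I : Type) (r : seq I) (P : pred I) (F : I -> bmfun) x :
  (\sum_(i <- r | P i) F i) x = \sum_(i <- r | P i) F i x.
Proof.
by elim/big_ind2 : _ => [|f a g b <- <-|//]; [exact: bmfun0|rewrite bmfunD].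
Qed.

Lemma bmfunP (f g : bmfun) : f =1 g -> f = g.
Proof. by move=> fg; apply/val_inj/funext. Qed.

Lemma bounded_measurable_comp (phi : R -> R) (f : bmfun) :
  measurable_fun setT phi -> {homo phi : x y / x <= y} ->
  phi \o f \in bounded_measurable.
Proof.
move=> mphi hphi; have [M fM] := bounded_bmfun f.
apply/bounded_measurableP; split.
  by apply: measurableT_comp => //; exact: measurable_bmfun.
exists (`|phi M| + `|phi (- M)|) => x /=.
have /andP[NM MM] : - M <= f x <= M by rewrite -ler_norml.
rewrite ler_norml; apply/andP; split.
  have := hphi _ _ NM; have := ler_norm (- phi (- M)); rewrite normrN.
  by have := normr_ge0 (phi M); lra.
have := hphi _ _ MM; have := ler_norm (phi M).
by have := normr_ge0 (phi (- M)); lra.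
Qed.

Lemma expR_bounded_measurable (f : bmfun) : expR \o f \in bounded_measurable.
Proof.
apply: bounded_measurable_comp; first exact: measurable_expR.
by move=> x y; rewrite ler_expR.
Qed.

Definition bmfun_expR (f : bmfun) : bmfun := BMFun (expR_bounded_measurable f).

Lemma cst_bounded_measurable (c : R) : cst c \in bounded_measurable.
Proof.
by apply/bounded_measurableP; split; [exact: measurable_cst|exists `|c|].
Qed.

Definition bmfun_cst (c : R) : bmfun := BMFun (cst_bounded_measurable c).

Lemma indic_bounded_measurable (A : set T) : measurable A ->
  \1_A \in bounded_measurable.
Proof.
move=> mA; apply/bounded_measurableP; split; first exact: measurable_indic.
by exists 1 => x; rewrite indicE; case: (x \in A); rewrite ?normr1 ?normr0.
Qed.

(** The indicator of [A], or [0] if [A] is not measurable: a set function built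
    from it is total. *)
Definition bmfun_indic (A : set T) : bmfun := insubd 0 (\1_A).

Lemma bmfun_indicE (A : set T) x : measurable A -> bmfun_indic A x = \1_A x.
Proof.
move=> mA; rewrite /bmfun_indic -[bmfun_val _]/(val _) val_insubd.
by rewrite indic_bounded_measurable.
Qed.

End bounded_measurable.
Arguments bmfun_cst {d T R}.
Arguments bmfun_indic {d T R}.

Section bmfun_integral.
Context d (T : measurableType d) (R : realType).
Implicit Types (mu nu : {finite_measure set T -> \bar R}) (f g : bmfun T R).

Lemma bmfun_integrable (mu : {measure set T -> \bar R}) f :
  (mu setT < +oo)%E -> mu.-integrable setT (EFin \o f).
Proof.
move=> muT; apply: measurable_bounded_integrable => //.
  exact: measurable_bmfun.
have [M fM] := bounded_bmfun f; exists M; split; first exact: num_real.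
by move=> K /ltW MK x _ /=; exact: le_trans (fM x) MK.
Qed.

Lemma bmfun_finite_integrable mu f : mu.-integrable setT (EFin \o f).
Proof. by apply: bmfun_integrable; exact/fin_num_fun_lty/fin_num_measure. Qed.

Lemma bmfun_integralE mu f : (\int[mu]_x (f x)%:E)%E = (\int[mu]_x f x)%:E.
Proof.
by rewrite /Rintegral fineK// integrable_fin_num//; exact: bmfun_finite_integrable.
Qed.

Lemma bmfun_integralD mu f g :
  \int[mu]_x (f + g) x = \int[mu]_x f x + \int[mu]_x g x.
Proof.
under eq_Rintegral do rewrite bmfunD.
by rewrite RintegralD//; exact: bmfun_finite_integrable.
Qed.

Lemma bmfun_integralZ mu (a : R) f :
  \int[mu]_x (a *: f) x = a * \int[mu]_x f x.
Proof.
under eq_Rintegral do rewrite bmfunZ.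
by rewrite RintegralZl//; exact: bmfun_finite_integrable.
Qed.

Lemma bmfun_integral_scalar mu :
  scalar (fun f : bmfun T R => \int[mu]_x f x).
Proof. by move=> a f g; rewrite bmfun_integralD bmfun_integralZ. Qed.

Definition bmfun_integral mu f : R := \int[mu]_x f x.

HB.instance Definition _ mu :=
  GRing.isLinear.Build R (bmfun T R) R *%R (bmfun_integral mu)
    (bmfun_integral_scalar mu).

Lemma bmfun_integral_le mu f g : (forall x, f x <= g x) ->
  \int[mu]_x f x <= \int[mu]_x g x.
Proof. by move=> fg; apply: le_Rintegral => //; exact: bmfun_finite_integrable. Qed.

Lemma bmfun_integral_cst (P : probability T R) (c : R) :
  \int[P]_x bmfun_cst c x = c.
Proof.
rewrite (@eq_Rintegral _ _ _ _ _ (cst c))//.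
by rewrite Rintegral_cst// [X in fine X]probability_setT mulr1.
Qed.

Lemma bmfun_integral_indic mu (A : set T) : measurable A ->
  \int[mu]_x bmfun_indic A x = fine (mu A).
Proof.
move=> mA; rewrite (@eq_Rintegral _ _ _ _ _ (\1_A)); last first.
  by move=> x _; exact: bmfun_indicE.
by rewrite /Rintegral integral_indic// setIT.
Qed.

End bmfun_integral.

(** * The cumulant functional *)

Section cumulant.
Context d (T : measurableType d) (R : realType) (nu : probability T R).
Implicit Types (f g : bmfun T R).

Definition cumulant f : R := ln (\int[nu]_x expR (f x)).

Lemma integral_expR_gt0 f : 0 < \int[nu]_x expR (f x).
Proof.
have [M fM] := bounded_bmfun f.
rewrite (lt_le_trans (expR_gt0 (- M)))// -[leLHS](bmfun_integral_cst nu).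
apply: (@bmfun_integral_le _ _ _ _ _ (bmfun_expR f)) => x /=.
by rewrite ler_expR lerNl; have := fM x; rewrite ler_norml => /andP[]; lra.
Qed.

Lemma expR_cumulant f : expR (cumulant f) = \int[nu]_x expR (f x).
Proof. by rewrite lnK// posrE integral_expR_gt0. Qed.

Lemma cumulant_le f (c : R) : \int[nu]_x expR (f x) <= expR c -> cumulant f <= c.
Proof. by move=> h; rewrite -ler_expR expR_cumulant. Qed.

Lemma expR_convex (s t x y : R) : 0 <= s -> 0 <= t -> s + t = 1 ->
  expR (s * x + t * y) <= s * expR x + t * expR y.
Proof.
move=> s0 t0 st; set w := s * x + t * y.
have tangent z : expR w * (1 + (z - w)) <= expR z.
  by rewrite -[in leRHS](subrKC w z) (expRD w) ler_wpM2l ?expR_ge0// expR_ge1Dx.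
have hx := ler_wpM2l s0 (tangent x); have hy := ler_wpM2l t0 (tangent y).
rewrite (le_trans _ (lerD hx hy))// le_eqVlt; apply/orP; left; apply/eqP.
have -> : s * (expR w * (1 + (x - w))) + t * (expR w * (1 + (y - w))) =
  expR w * ((s + t) + (s * x + t * y) - (s + t) * w) by ring.
by rewrite st mul1r -/w addrK mulr1.
Qed.

(** With [f] and [g] shifted to have cumulant [0], the exponential of their
    convex combination is at most the combination of their exponentials, whose
    integral is [1]. *)
Lemma cumulant_convex : convex_fun setT cumulant.
Proof.
move=> f g s t _ _ s0 t0 st; apply: cumulant_le.
have [e eE] : exists e, e = expR (s * cumulant f + t * cumulant g) by eexists.
pose F := bmfun_expR f; pose G := bmfun_expR g.
pose K := e *: (s *: (expR (- cumulant f) *: F) + t *: (expR (- cumulant g) *: G)).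
have KE : \int[nu]_x K x = e.
  have FE : \int[nu]_x F x = expR (cumulant f) by rewrite expR_cumulant.
  have GE : \int[nu]_x G x = expR (cumulant g) by rewrite expR_cumulant.
  rewrite bmfun_integralZ bmfun_integralD !bmfun_integralZ FE GE.
  have expN u : expR (- u) * expR u = 1 :> R by rewrite -expRD addNr expR0.
  transitivity (e * (s * 1 + t * 1)); last by rewrite !mulr1 st mulr1.
  by congr (_ * (_ * _ + _ * _)); exact: expN.
rewrite -eE -[leRHS]KE.
apply: (@bmfun_integral_le _ _ _ _ (bmfun_expR (s *: f + t *: g))) => x.
rewrite -[leLHS]/(expR ((s *: f + t *: g) x)) /K !(bmfunD, bmfunZ).
rewrite -[F x]/(expR (f x)) -[G x]/(expR (g x)).
have := expR_convex (f x - cumulant f) (g x - cumulant g) s0 t0 st.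
rewrite (expRD (f x)) (expRD (g x)) => /(ler_wpM2l (expR_ge0 _)).
move=> /(_ (s * cumulant f + t * cumulant g)); rewrite -eE => h.
rewrite [X in expR X](_ : _ = (s * cumulant f + t * cumulant g) +
  (s * (f x - cumulant f) + t * (g x - cumulant g))); last by ring.
rewrite expRD -eE (le_trans h)// le_eqVlt; apply/orP; left; apply/eqP.
by congr (_ * (_ * _ + _ * _)); exact: mulrC.
Qed.

Lemma cumulant_cst (c : R) : cumulant (bmfun_cst c) = c.
Proof.
rewrite /cumulant (@eq_Rintegral _ _ _ _ _ (bmfun_cst (expR c)))//.
by rewrite bmfun_integral_cst expRK.
Qed.

Lemma cumulant_le0 f : (forall x, f x <= 0) -> cumulant f <= 0.
Proof.
move=> f0; rewrite -[leRHS]cumulant_cst; apply: cumulant_le.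
rewrite cumulant_cst -[leRHS](bmfun_integral_cst nu).
apply: (@bmfun_integral_le _ _ _ _ (bmfun_expR f)) => x /=.
by rewrite ler_expR.
Qed.

(** The chord of the exponential over [0, 1] lies above it, and
    [ln (1 + u) <= u]. *)
Lemma cumulant_scale_le (t : R) f : (forall x, 0 <= f x <= 1) ->
  cumulant (t *: f) <= (expR t - 1) * \int[nu]_x f x.
Proof.
move=> f01; apply: cumulant_le; rewrite (le_trans _ (expR_ge1Dx _))//.
rewrite -bmfun_integralZ -[X in X + _](bmfun_integral_cst nu) -bmfun_integralD.
apply: (@bmfun_integral_le _ _ _ _ (bmfun_expR (t *: f))) => x.
rewrite -[leLHS]/(expR ((t *: f) x)) bmfunD !bmfunZ.
have /andP[f0 f1] := f01 x.
have f1' : 0 <= 1 - f x by lra.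
have := expR_convex t 0 f0 f1' (subrKC _ _).
rewrite mulr0 addr0 expR0 mulrC => /le_trans; apply.
rewrite -[bmfun_cst 1 x]/(1 : R) le_eqVlt; apply/orP; left; apply/eqP.
by rewrite [(1 - _) * 1]mulr1 mulrBl mul1r [f x * _]mulrC addrCA.
Qed.

End cumulant.

(** * The measure below a linear minorant of the cumulant functional *)

Lemma bounded_multiples_le0 (R : realType) (y K : R) :
  (forall t, 0 <= t -> t * y <= K) -> y <= 0.
Proof.
move=> yK; rewrite leNgt; apply/negP => y0.
have t0 : 0 <= (`|K| + 1) / y by rewrite divr_ge0 ?addr_ge0// ltW.
by have := yK _ t0; rewrite divfK ?gt_eqF//; have := ler_norm K; lra.
Qed.

(** The sum rounds [y] down to a multiple of [e]. *)
Lemma layer_sum (R : realType) (e y : R) (K : nat) : 0 < e -> 0 <= y <= K%:R * e ->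
  let s := \sum_(k < K) e * (k.+1%:R * e <= y)%R%:R in s <= y <= s + e.
Proof.
move=> e0 /=; elim: K y => [|K IH] y yK.
  by rewrite big_ord0; lra.
rewrite big_ord_recl/= mul1r; have [ey|ye] := leP e y.
  have {}yK : 0 <= y - e <= K%:R * e.
    by move: yK; rewrite -natr1 mulrDl mul1r; lra.
  have := IH _ yK.
  under eq_bigr => k _.
    rewrite (_ : (k.+1%:R * e <= y - e) = ((bump 0 k).+1%:R * e <= y)); first over.
    by rewrite /bump/= add1n -[k.+2%:R]natr1 mulrDl mul1r lerBrDr.
  by rewrite mulr1; lra.
rewrite big1 ?mulr0; first by lra.
move=> k _; rewrite (_ : (_ <= y) = false) ?mulr0//; apply/negbTE.
by rewrite -ltNge (lt_le_trans ye)// ler_peMl ?(ltW e0)// ler1n.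
Qed.

Section measure_of_cumulant_minorant.
Context d (T : measurableType d) (R : realType) (nu : probability T R).
Variables (L : {scalar bmfun T R}) (c : R).
Implicit Types (f g : bmfun T R) (a t : R).
Hypothesis Lnu : forall f, L f + c <= cumulant nu f.

(** The cumulant of [- t *: f] is at most [0] for every [0 <= t], whence
    [t * - L f <= - c]. *)
Lemma cumulant_minorant_ge0 f : (forall x, 0 <= f x) -> 0 <= L f.
Proof.
move=> f0; rewrite -oppr_le0; apply: (@bounded_multiples_le0 _ _ (- c)) => t t0.
have : cumulant nu (- t *: f) <= 0.
  by apply: cumulant_le0 => x; rewrite bmfunZ mulNr oppr_le0 mulr_ge0.
by move=> /(le_trans (Lnu _)); rewrite linearZ/=; lra.
Qed.

Lemma cumulant_minorant_le f g : (forall x, f x <= g x) -> L f <= L g.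
Proof.
move=> fg; rewrite -subr_ge0 -linearB; apply: cumulant_minorant_ge0 => x.
by rewrite bmfunB subr_ge0.
Qed.

(** The cumulant of the constant [t] is [t], and a linear function of [t] that
    stays below a constant is zero. *)
Lemma cumulant_minorant_cst a : L (bmfun_cst a) = a.
Proof.
have tL t : t * (L (bmfun_cst 1) - 1) <= - c.
  have := Lnu (t *: bmfun_cst 1).
  rewrite (_ : cumulant _ _ = t); first by rewrite linearZ/=; lra.
  rewrite -[RHS](cumulant_cst nu); congr (cumulant _ _).
  by apply: bmfunP => x; rewrite bmfunZ/= mulr1.
have L1 : L (bmfun_cst 1) = 1.
  have h1 : L (bmfun_cst 1) - 1 <= 0 by exact: bounded_multiples_le0 (fun t _ => tL t).
  have h2 : - (L (bmfun_cst 1) - 1) <= 0.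
    apply: (@bounded_multiples_le0 _ _ (- c)) => t _.
    by rewrite mulrN -mulNr.
  by apply/le_anti; lra.
have -> : bmfun_cst a = a *: bmfun_cst 1 :> bmfun T R.
  by apply: bmfunP => x; rewrite bmfunZ/= mulr1.
by rewrite linearZ/= L1 mulr1.
Qed.

Lemma cumulant_minorant_scale_le t f : (forall x, 0 <= f x <= 1) ->
  t * L f <= - c + (expR t - 1) * \int[nu]_x f x.
Proof.
move=> f01; have := le_trans (Lnu _) (cumulant_scale_le nu t f01).
by rewrite linearZ/=; lra.
Qed.

Definition minorant_measure (A : set T) : \bar R := (L (bmfun_indic A))%:E.

Let minorant_measure0 : minorant_measure set0 = 0%E.
Proof.
rewrite /minorant_measure (_ : bmfun_indic set0 = 0) ?linear0//.
by apply: bmfunP => x; rewrite bmfun_indicE// indic0 bmfun0.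
Qed.

Lemma bmfun_indic_ge0 (A : set T) x : 0 <= bmfun_indic A x :> R.
Proof.
have [mA|nmA] := pselect (measurable A); first by rewrite bmfun_indicE// indicE.
rewrite /bmfun_indic -[bmfun_val _]/(val _) val_insubd.
case: ifPn => [/bounded_measurableP[/measurable_indicP]//|_].
by rewrite -[val 0]/(bmfun_val 0) bmfun0.
Qed.

Let minorant_measure_ge0 A : (0 <= minorant_measure A)%E.
Proof.
by rewrite lee_fin; apply: cumulant_minorant_ge0 => x; exact: bmfun_indic_ge0.
Qed.

(** Countable additivity: the difference [r n] between the indicator of a
    disjoint union and its [n]-th partial sum has [nu]-integral tending to [0],
    and [t * L (r n) <= - c + (expR t - 1) * \int[nu]_x r n x] for every [t];
    a large [t] makes the contribution of [- c] small. *)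
Let minorant_measure_sigma_additive : semi_sigma_additive minorant_measure.
Proof.
move=> F mF tF mU; set U := \bigcup_n F n.
pose r n := bmfun_indic U - \sum_(0 <= i < n) bmfun_indic (F i) : bmfun T R.
have r01 n x : 0 <= r n x <= 1.
  rewrite /r bmfunB bmfun_sum bmfun_indicE//.
  have [[k _ Fkx]|nUx] := pselect (U x); last first.
    rewrite indicE memNset//= big1 ?subr0 ?lexx ?ler01// => i _.
    by rewrite bmfun_indicE// indicE memNset// => Fix; apply: nUx; exists i.
  rewrite indicE mem_set; last by exists k.
  have -> : \sum_(0 <= i < n) bmfun_indic (F i) x = (k < n)%:R :> R.
    have Fi i : i != k -> bmfun_indic (F i) x = 0 :> R.
      move=> ik; rewrite bmfun_indicE// indicE memNset// => Fix.
      have /trivIsetP/(_ i k I I ik) := tF.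
      by move/seteqP => [/(_ x) + _]; apply.
    have [kn|nk] := ltnP k n.
      rewrite (bigD1_seq k)/= ?mem_index_iota ?iota_uniq//.
      by rewrite bmfun_indicE// indicE mem_set// big1 ?addr0.
    rewrite big_nat_cond big1// => i /andP[/andP[_ iN] _]; apply: Fi.
    by rewrite ltn_eqF// (leq_trans iN).
  by case: (k < n)%N; rewrite ?subrr ?subr0 ?lexx ?ler01.
have Lr n : L (r n) = L (bmfun_indic U) - \sum_(0 <= i < n) L (bmfun_indic (F i)).
  by rewrite linearB/= linear_sum.
have nur : \int[nu]_x (r n) x @[n --> \oo] --> (0 : R).
  have -> : (fun n => \int[nu]_x (r n) x) =
      (fun n => fine (nu U) - fine (\sum_(0 <= i < n) nu (F i))%E).
    apply/funext => n; rewrite -[LHS]/(bmfun_integral nu (r n)).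
    rewrite linearB linear_sum/= /bmfun_integral bmfun_integral_indic//.
    congr (_ - _); rewrite -sum_fine; last by move=> i _; rewrite fin_num_measure.
    by apply: eq_bigr => i _; rewrite bmfun_integral_indic.
  rewrite -(subrr (fine (nu U))); apply: cvgB; first exact: cvg_cst.
  apply: fine_cvg; rewrite fineK ?fin_num_measure//.
  exact: measure_semi_sigma_additive.
have Lr0 : L (r n) @[n --> \oo] --> (0 : R).
  have c0 : 0 <= - c.
    have := Lnu 0; rewrite linear0 add0r => /le_trans h; rewrite oppr_ge0.
    by apply: h; apply: cumulant_le0 => x; rewrite bmfun0.
  (* [t] is such that [- c + 1 = t * e]: it remains to have
     [expR t * \int[nu]_x r n x <= 1] *)
  apply/cvgrPdist_le => e e0; pose t := (- c + 1) / e.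
  have t0 : 0 < t by rewrite divr_gt0// ltr_wpDl.
  have /cvgrPdist_le/(_ _ (expR_gt0 (- t))) := nur.
  apply: filterS => n; rewrite !sub0r !normrN => rn.
  rewrite ger0_norm; last first.
    by apply: cumulant_minorant_ge0 => x; case/andP: (r01 n x).
  rewrite -(ler_pM2l t0) {2}/t divfK ?gt_eqF//.
  rewrite (le_trans (cumulant_minorant_scale_le t (r01 n)))// lerD2l.
  have r0 : 0 <= \int[nu]_x (r n) x.
    by apply: Rintegral_ge0 => x _; case/andP: (r01 n x).
  rewrite (@le_trans _ _ (expR t * \int[nu]_x (r n) x))//.
    by rewrite ler_wpM2r// gerBl.
  rewrite -ler_pdivlMl ?expR_gt0// mulr1 -expRN.
  by rewrite (le_trans (ler_norm _)).
rewrite /minorant_measure.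
have -> : (fun n => \sum_(0 <= i < n) (L (bmfun_indic (F i)))%:E)%E =
    EFin \o (fun n => L (bmfun_indic U) - L (r n)).
  by apply/funext => n /=; rewrite Lr subKr sumEFin.
apply: cvg_EFin; first exact: nearW.
rewrite -[X in _ --> X]subr0.
by apply: cvgB => //; exact: cvg_cst.
Qed.

HB.instance Definition _ := isMeasure.Build d T R minorant_measure
  minorant_measure0 minorant_measure_ge0 minorant_measure_sigma_additive.

Let minorant_measure_setT : minorant_measure setT = 1%E.
Proof.
rewrite /minorant_measure (_ : bmfun_indic setT = bmfun_cst 1).
  by rewrite cumulant_minorant_cst.
by apply: bmfunP => x; rewrite bmfun_indicE// indicT.
Qed.

HB.instance Definition _ := Measure_isProbability.Build d T R minorant_measure
  minorant_measure_setT.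

Lemma minorant_measure_dominates : minorant_measure `<< nu.
Proof.
move=> N N0 A mA AN; apply/eqP; rewrite eq_le minorant_measure_ge0 andbT.
rewrite lee_fin; apply: (@bounded_multiples_le0 _ _ (- c)) => t _.
have := @cumulant_minorant_scale_le t (bmfun_indic A) _.
rewrite bmfun_integral_indic// [X in fine X](N0 _ mA AN) mulr0 addr0; apply => x.
by rewrite bmfun_indicE// indicE; case: (_ \in _); rewrite /= ?lexx ?ler01.
Qed.

(** Both sides are monotone and linear and agree on indicators; a nonnegative
    function is within [e] of a finite combination of indicators of its
    superlevel sets. *)
Lemma minorant_measure_integral f : \int[minorant_measure]_x f x = L f.
Proof.
suff ge0 (g : bmfun T R) : (forall x, 0 <= g x) ->
    \int[minorant_measure]_x g x = L g.
  have [M fM] := bounded_bmfun f.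
  have fM0 x : 0 <= (f + bmfun_cst M) x.
    by rewrite bmfunD/=; have := fM x; rewrite ler_norml; lra.
  have := ge0 _ fM0; rewrite bmfun_integralD linearD/= cumulant_minorant_cst.
  by rewrite bmfun_integral_cst => /addIr.
move=> g0; have [M gM] := bounded_bmfun g.
suff close e : 0 < e -> `|\int[minorant_measure]_x g x - L g| <= e.
  apply/eqP; rewrite -subr_eq0 -normr_le0; apply/ler_addgt0Pr => e e0.
  by rewrite add0r close.
move=> e0.
pose K := (Num.truncn (M / e)).+1.
pose A k := [set x | k.+1%:R * e <= g x].
have mA k : measurable (A k).
  rewrite -[X in measurable X]setTI.
  have -> : A k = g @^-1` `[k.+1%:R * e, +oo[%classic.
    by apply/seteqP; split=> x /=; rewrite in_itv/= andbT.
  exact: measurable_bmfun.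
pose s : bmfun T R := \sum_(k < K) e *: bmfun_indic (A k).
have sg x : s x <= g x <= s x + e.
  have gK : 0 <= g x <= K%:R * e.
    rewrite g0 (le_trans (ler_norm _))// (le_trans (gM x))//.
    by rewrite -ler_pdivrMr// ltW// truncnS_gt.
  rewrite /s bmfun_sum (eq_bigr (fun k : 'I_K => e * (k.+1%:R * e <= g x)%R%:R)).
    exact: layer_sum.
  move=> k _; rewrite bmfunZ bmfun_indicE// indicE; congr (_ * (nat_of_bool _)%:R).
  by apply/idP/idP; rewrite inE.
have sE : \int[minorant_measure]_x s x = L s.
  rewrite -[LHS]/(bmfun_integral minorant_measure s) !linear_sum.
  apply: eq_bigr => k _.
  by rewrite !linearZ/= /bmfun_integral bmfun_integral_indic.
have le1 f1 f2 := @bmfun_integral_le _ _ _ minorant_measure f1 f2.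
have gse x : g x <= (s + bmfun_cst e) x.
  by rewrite bmfunD/=; case/andP: (sg x).
have sgx x : s x <= g x by case/andP: (sg x).
have h1 := le1 _ _ sgx; have h2 := le1 _ _ gse.
have h3 := cumulant_minorant_le sgx; have h4 := cumulant_minorant_le gse.
move: h2 h4; rewrite bmfun_integralD linearD/=.
rewrite cumulant_minorant_cst bmfun_integral_cst.
by rewrite ler_norml; move: h1 h3; rewrite sE; lra.
Qed.

Lemma cumulant_minorant_integral :
  exists2 gamma : probability T R, gamma `<< nu &
    forall f, \int[gamma]_x f x = L f.
Proof.
exists (minorant_measure : probability T R).
  exact: minorant_measure_dominates.
exact: minorant_measure_integral.
Qed.

End measure_of_cumulant_minorant.

(** * The Donsker-Varadhan variational formula for relative entropy *)

Section ae_le_integral.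
Context d (T : measurableType d) (R : realType) (mu : {measure set T -> \bar R}).
Local Open Scope ereal_scope.

(** The integral of a positive part increases with the function, that of a
    negative part decreases: their difference is monotone even when it is
    infinite. *)
Lemma ae_le_integral (f g : T -> \bar R) :
  measurable_fun setT f -> measurable_fun setT g ->
  (\forall x \ae mu, f x <= g x) -> \int[mu]_x f x <= \int[mu]_x g x.
Proof.
move=> mf mg fg; rewrite integralE [leRHS]integralE; apply: leeB.
  apply: ae_ge0_le_integral => //; try exact: measurable_funepos.
  apply: filterS fg => x fgx _.
  by apply: (@funepos_le _ _ [set x]); rewrite ?inE// => y /[!inE] ->.
apply: ae_ge0_le_integral => //; try exact: measurable_funeneg.
apply: filterS fg => x fgx _.
by apply: (@funeneg_le _ _ [set x]); rewrite ?inE// => y /[!inE] ->.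
Qed.

End ae_le_integral.

Section donsker_varadhan.
Context d (T : measurableType d) (R : realType) (gamma nu : probability T R).
Hypothesis gamma_nu : gamma `<< nu.
Local Open Scope charge_scope.

Let D := 'd (charge_of_finite_measure gamma) '/d nu.

(* A version of [D] that is nonnegative at every point. *)
Let h x := fine (Radon_Nikodym_SigmaFinite.f gamma nu x).

Let h_ge0 x : 0 <= h x.
Proof. by rewrite fine_ge0// Radon_Nikodym_SigmaFinite.f_ge0. Qed.

Let hE x : Radon_Nikodym_SigmaFinite.f gamma nu x = (h x)%:E.
Proof. by rewrite fineK// Radon_Nikodym_SigmaFinite.f_fin_num. Qed.

Let measurable_h : measurable_fun setT h.
Proof.
apply: measurableT_comp; first exact: fine_measurable.
exact: measurable_int (Radon_Nikodym_SigmaFinite.f_integrable gamma_nu).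
Qed.

Let integral_density (f : T -> \bar R) : (forall x, 0 <= f x)%E ->
  measurable_fun setT f ->
  (\int[nu]_x (f x * (h x)%:E) = \int[gamma]_x f x)%E.
Proof.
move=> f0 mf; rewrite -(Radon_Nikodym_SigmaFinite.change_of_variables gamma_nu)//.
by apply: eq_integral => x _; rewrite hE.
Qed.

Let ae_density_gt0 : \forall x \ae gamma, 0 < h x.
Proof.
pose N := [set x | h x <= 0].
have mN : measurable N.
  rewrite -[X in measurable X]setTI.
  have -> : N = h @^-1` `]-oo, 0]%classic.
    by apply/seteqP; split=> x /=; rewrite in_itv.
  exact: measurable_h.
exists N; split=> //; last by move=> x /= /negP; rewrite -leNgt.
rewrite -(setIT N) -integral_indic// -integral_density//; last first.
  by apply/measurable_EFinP; exact: measurable_indic.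
apply: integral0_eq => x _; rewrite indicE.
have [xN|xN] := boolP (x \in N); last by rewrite mul0e.
have hx0 : h x = 0 by apply/le_anti; rewrite h_ge0 andbT; exact: set_mem xN.
by rewrite hx0 mule0.
Qed.

Let measurable_lne_density : measurable_fun setT (fun x => lne (D x)).
Proof.
have mD : measurable_fun setT (fine \o D).
  apply: measurableT_comp; first exact: fine_measurable.
  by apply: measurable_int; exact: Radon_Nikodym_integrable.
have Dfin x : D x \is a fin_num by exact: Radon_Nikodym_fin_num.
have -> : (fun x => lne (D x)) =
    (fun x => if fine (D x) <= 0 then -oo%E else (ln (fine (D x)))%:E).
  by apply/funext => x; rewrite -{1}(fineK (Dfin x)).
apply: measurable_fun_ifT => //.
  by apply: measurable_fun_ler => //; exact: measurable_cst.
by apply/measurable_EFinP; apply: measurableT_comp => //; exact: measurable_ln.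
Qed.

Let measurable_ln_h : measurable_fun setT (fun x => (ln (h x))%:E).
Proof.
by apply/measurable_EFinP; apply: measurableT_comp => //; exact: measurable_ln.
Qed.

Let integral_lne_density :
  (\int[gamma]_x lne (D x) = \int[gamma]_x (ln (h x))%:E)%E.
Proof.
apply: ae_eq_integral => //.
have /(null_dominates_ae_eq measurableT gamma_nu) :=
  ae_eq_Radon_Nikodym_SigmaFinite gamma_nu measurableT.
apply: filterS2 ae_density_gt0 => x hx /(_ I) fD _.
by rewrite /D -fD hE lne_EFin.
Qed.

(** Young's inequality [u <= ln h - 1 + expR u / h], integrated against [gamma]
    with [u = f - cumulant nu f]. *)
Lemma cumulant_le_entropy (f : bmfun T R) :
  ((\int[gamma]_x f x - cumulant nu f)%:E <= \int[gamma]_x lne (D x))%E.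
Proof.
rewrite integral_lne_density.
pose E x := expR (f x - cumulant nu f - ln (h x)).
have mE : measurable_fun setT E.
  apply: measurableT_comp; first exact: measurable_expR.
  apply: measurable_funB; last first.
    by apply: measurableT_comp => //; exact: measurable_ln.
  by apply: measurable_funB; [exact: measurable_bmfun|exact: measurable_cst].
have E0 x : 0 <= E x by exact: expR_ge0.
(* [E * h <= k] pointwise, with equality where [h] is positive *)
pose k : bmfun T R := expR (- cumulant nu f) *: bmfun_expR f.
have intk : \int[nu]_x k x = 1.
  rewrite bmfun_integralZ -[X in _ * X]/(\int[nu]_x expR (f x)) -expR_cumulant.
  by rewrite -expRD addNr expR0.
have intE : (\int[gamma]_x (E x)%:E <= 1)%E.
  rewrite -integral_density//; last exact/measurable_EFinP.
  rewrite -[leRHS]/(1%:E) -[X in (_ <= X%:E)%E]intk -bmfun_integralE.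
  apply: ge0_le_integral => //.
  - by move=> x _; rewrite lee_fin mulr_ge0.
  - by apply/measurable_EFinP; exact: measurable_funM.
  - by apply/measurable_EFinP; exact: measurable_bmfun.
  - move=> x _; rewrite lee_fin bmfunZ -[bmfun_expR f x]/(expR (f x)).
    have := h_ge0 x; rewrite le_eqVlt => /predU1P[<-|hx].
      by rewrite mulr0 mulr_ge0 ?expR_ge0.
    by rewrite /E expRB lnK// divfK ?gt_eqF// expRD mulrC.
have Eint : gamma.-integrable setT (EFin \o E).
  apply/integrableP; split; first exact/measurable_EFinP.
  under eq_integral do rewrite gee0_abs ?lee_fin//.
  by rewrite (le_lt_trans intE)// ltry.
pose u : bmfun T R := f + bmfun_cst (1 - cumulant nu f).
have intu : (\int[gamma]_x (u x)%:E = (\int[gamma]_x f x - cumulant nu f + 1)%:E)%E.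
  rewrite bmfun_integralE bmfun_integralD bmfun_integral_cst.
  by congr (_%:E); ring.
have uint : gamma.-integrable setT (EFin \o u) by exact: bmfun_finite_integrable.
apply: (@le_trans _ _ (\int[gamma]_x ((u x)%:E - (E x)%:E))%E).
  rewrite (integralB_EFin measurableT uint Eint) intu.
  rewrite [X in (_ <= X - _)%E]EFinD -addeA leeDl//.
  by rewrite sube_ge0 ?orbT.
apply: ae_le_integral => //.
  by apply/measurable_EFinP; apply: measurable_funB => //; exact: measurable_bmfun.
apply: filterS ae_density_gt0 => x hx.
have := expR_ge1Dx (f x - cumulant nu f - ln (h x)).
by rewrite -EFinB lee_fin bmfunD -[bmfun_cst _ x]/(1 - cumulant nu f) -/(E x); lra.
Qed.

(** The test functions [ln (min h n + e)] are bounded and their cumulant is at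
    most [ln (1 + e) <= e]; let [n] tend to infinity by monotone convergence,
    then [e] to [0]. *)
Lemma entropy_le (c : R) :
  (forall f : bmfun T R, \int[gamma]_x f x + c <= cumulant nu f) ->
  (\int[gamma]_x lne (D x) <= (- c)%:E)%E.
Proof.
move=> fc; rewrite integral_lne_density; apply/lee_addgt0Pr.
suff le_e (e : R) : 0 < e ->
    (\int[gamma]_x (ln (h x))%:E <= (- c)%:E + e%:E)%E by exact: le_e.
move=> e0.
have hn_gt0 n x : 0 < Num.min (h x) n%:R + e.
  by rewrite ltr_wpDl// le_min h_ge0/=.
have mhn n : measurable_fun setT (fun x => ln (Num.min (h x) n%:R + e)).
  apply: measurableT_comp; first exact: measurable_ln.
  apply: measurable_funD; last exact: measurable_cst.
  by apply: measurable_minr => //; exact: measurable_cst.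
have ln_ge n x : ln e <= ln (Num.min (h x) n%:R + e).
  by rewrite ler_ln ?posrE// lerDr le_min h_ge0/=.
have ln_le n x : ln (Num.min (h x) n%:R + e) <= ln (n%:R + e).
  by rewrite ler_ln ?posrE// ?ltr_wpDl// lerD2r ge_min lexx orbT.
have bmn n : (fun x => ln (Num.min (h x) n%:R + e)) \in @bounded_measurable _ T R.
  apply/bounded_measurableP; split=> //.
  exists (`|ln e| + `|ln (n%:R + e)|) => x; rewrite ler_norml.
  have := ln_ge n x; have := ln_le n x.
  have := ler_norm (- ln e); have := ler_norm (ln (n%:R + e)).
  have := normr_ge0 (ln e); have := normr_ge0 (ln (n%:R + e)).
  by rewrite normrN; lra.
pose f n : bmfun T R := BMFun (bmn n).
have hint : nu.-integrable setT (EFin \o h).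
  have := Radon_Nikodym_SigmaFinite.f_integrable gamma_nu.
  by congr (_.-integrable _ _); apply/funext => x /=; rewrite hE.
have int_h : \int[nu]_x h x = 1.
  rewrite /Rintegral (_ : \int[nu]_x _ = 1)%E//.
  transitivity (\int[nu]_x (1 * (h x)%:E))%E.
    by apply: eq_integral => x _; rewrite mul1e.
  rewrite (@integral_density (cst 1%E))//.
  by rewrite integral_cst// mul1e; exact: probability_setT.
have cumf n : cumulant nu (f n) <= e.
  apply: cumulant_le; rewrite (le_trans _ (expR_ge1Dx e))//.
  rewrite -[X in X + _]int_h -[X in _ + X](bmfun_integral_cst nu).
  rewrite -RintegralD//; last exact: bmfun_finite_integrable.
  apply: le_Rintegral => //.
  - exact: (bmfun_finite_integrable nu (bmfun_expR (f n))).
  - apply: (@eq_integrable _ _ _ _ _ measurableT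
      ((EFin \o h) \+ (EFin \o bmfun_cst e))%E) => //.
    by apply: integrableD => //; exact: bmfun_finite_integrable.
  - by move=> x _ /=; rewrite lnK ?posrE// lerD2r ge_min lexx.
have intf n : (\int[gamma]_x (f n x - ln e)%:E <= (e - c - ln e)%:E)%E.
  rewrite -[X in (X <= _)%E]/(
    \int[gamma]_x ((f n x)%:E - (bmfun_cst (ln e) x)%:E))%E.
  rewrite integralB_EFin//; try exact: bmfun_finite_integrable.
  rewrite !bmfun_integralE bmfun_integral_cst -EFinB lee_fin lerD2r.
  by have := fc (f n); have := cumf n; lra.
pose q x := ln (h x + e) - ln e.
have q0 x : 0 <= q x by rewrite subr_ge0 ler_ln ?posrE ?ltr_wpDl// lerDr.
have mq : measurable_fun setT q.
  apply: measurable_funB; last exact: measurable_cst.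
  apply: measurableT_comp; first exact: measurable_ln.
  by apply: measurable_funD => //; exact: measurable_cst.
have intq : (\int[gamma]_x (q x)%:E <= (e - c - ln e)%:E)%E.
  have mono m n x : (m <= n)%N -> f m x - ln e <= f n x - ln e.
    move=> mn; rewrite lerD2r /f/= ler_ln ?posrE// lerD2r.
    by rewrite le_min !ge_min lexx/= ler_nat mn orbT.
  have -> : (\int[gamma]_x (q x)%:E =
             \int[gamma]_x limn (fun n => (f n x - ln e)%:E))%E.
    apply: eq_integral => x _; apply/esym/cvg_lim => //.
    apply: cvg_near_cst; exists (Num.truncn (h x)).+1 => // n /= hn.
    rewrite /q /f/= min_l// ltW// (lt_le_trans (truncnS_gt _))//.
    by rewrite ler_nat.
  rewrite (monotone_convergence gamma measurableT); first last.
  - by move=> x _ m n mn; rewrite lee_fin mono.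
  - by move=> n x _; rewrite lee_fin subr_ge0 ln_ge.
  - move=> n; apply/measurable_EFinP; apply: measurable_funB => //.
    exact: measurable_bmfun.
  apply: lime_le; last exact: nearW.
  apply: ereal_nondecreasing_is_cvgn => m n mn; apply: ge0_le_integral => //.
  - by move=> x _; rewrite lee_fin subr_ge0 ln_ge.
  - apply/measurable_EFinP; apply: measurable_funB => //.
    exact: measurable_bmfun.
  - apply/measurable_EFinP; apply: measurable_funB => //.
    exact: measurable_bmfun.
  - by move=> x _; rewrite lee_fin mono.
have qint : gamma.-integrable setT (EFin \o q).
  apply/integrableP; split; first exact/measurable_EFinP.
  under eq_integral do rewrite gee0_abs ?lee_fin//.
  by rewrite (le_lt_trans intq)// ltry.
apply: (@le_trans _ _ (\int[gamma]_x ((q x)%:E + (bmfun_cst (ln e) x)%:E))%E).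
  apply: ae_le_integral => //.
    by apply/measurable_EFinP; apply: measurable_funD.
  apply: filterS ae_density_gt0 => x hx.
  by rewrite -EFinD lee_fin subrK ler_ln ?posrE ?addr_gt0// lerDl ltW.
rewrite (integralD_EFin measurableT qint (bmfun_finite_integrable _ _)).
rewrite [X in (_ + X)%E]bmfun_integralE bmfun_integral_cst.
rewrite (le_trans (leeD2r _ intq))// -!EFinD lee_fin.
by lra.
Qed.

End donsker_varadhan.

(** * Integration against finite signed measures *)

Section charge_integral.
Context d (T : measurableType d) (R : realType).
Implicit Types (mu : {charge set T -> \bar R}) (f : bmfun T R).

Lemma charge_integralE mu :
  exists P N : {finite_measure set T -> \bar R},
    (forall A, measurable A -> mu A = (P A - N A)%E) /\
    (forall f, charge_integral mu f = \int[P]_x f x - \int[N]_x f x).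
Proof.
set muPN := svalP (cid (svalP (cid (Hahn_decomposition mu)))).
exists (jordan_pos muPN), (jordan_neg muPN); split=> // A mA.
by rewrite {1}(jordan_decomp muPN mA) /cadd/= cscaleN1.
Qed.

Lemma charge_integral_scalar mu :
  scalar (fun f => charge_integral mu f).
Proof.
have [P [N [_ muE]]] := charge_integralE mu.
by move=> a f g; rewrite !muE !bmfun_integralD !bmfun_integralZ; ring.
Qed.

Definition charge_functional mu f : R := charge_integral mu f.

HB.instance Definition _ mu :=
  GRing.isLinear.Build R (bmfun T R) R *%R (charge_functional mu)
    (charge_integral_scalar mu).

Lemma bmfun_integral_measure_add (m1 m2 : {measure set T -> \bar R}) f :
  (m1 setT < +oo)%E -> (m2 setT < +oo)%E ->
  \int[measure_add m1 m2]_x f x = \int[m1]_x f x + \int[m2]_x f x.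
Proof.
move=> m1T m2T.
rewrite /Rintegral integral_measure_add//; try exact: bmfun_integrable.
by rewrite fineD//; apply: integrable_fin_num => //; exact: bmfun_integrable.
Qed.

End charge_integral.

(** The two Jordan decompositions are compared through the identity
    [P' + (N + gamma) = P + N'] of positive measures. *)
Lemma charge_integral_sub (R : realType) (S : ptopologicalType)
    (mu : {charge set (borel S) -> \bar R}) (gamma : probability (borel S) R)
    (f : bmfun (borel S) R) :
  charge_integral (charge_sub mu gamma) f =
  charge_integral mu f - \int[gamma]_x f x.
Proof.
have [P [N [muPN ->]]] := charge_integralE mu.
have [P' [N' [subPN ->]]] := charge_integralE (charge_sub mu gamma).
have rearrange (p n p' n' g : \bar R) : p \is a fin_num -> n \is a fin_num ->
    p' \is a fin_num -> n' \is a fin_num -> g \is a fin_num ->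
    (p - n - g = p' - n')%E -> (p' + (n + g) = p + n')%E.
  move: p n p' n' g => [p| |] [n| |] [p'| |] [n'| |] [g| |] // _ _ _ _ _.
  by move=> -[h]; congr (_%:E); lra.
have eqm : \int[measure_add P' (measure_add N gamma)]_x f x =
           \int[measure_add P N']_x f x.
  congr fine; apply: eq_measure_integral => A mA _.
  rewrite [LHS]measure_addE [X in (_ + X)%E]measure_addE [RHS]measure_addE.
  apply: rearrange; rewrite ?fin_num_measure//.
  by rewrite -muPN// -subPN.
have fin (m : {finite_measure set (borel S) -> \bar R}) : (m setT < +oo)%E.
  exact/fin_num_fun_lty/fin_num_measure.
have fin_add : (measure_add N gamma setT < +oo)%E.
  by rewrite [X in (X < _)%E]measure_addE; apply: lte_add_pinfty; exact: fin.
rewrite !bmfun_integral_measure_add// in eqm; try exact: fin.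
by lra.
Qed.

(** * Duality for the Gamma-divergence *)

Section continuous_test_functions.
Context (R : realType) (S : ptopologicalType).

Lemma Cb_bounded_measurable (g : Cb R S) :
  (g : borel S -> R) \in @bounded_measurable _ (borel S) R.
Proof.
have /bounded_continuousP[cg [M [_ gM]]] := valP g.
apply/bounded_measurableP; split; last first.
  by exists (M + 1) => x; apply: gM => //; rewrite ltrDl.
apply: (measurability _ (RGenOpens.measurableE R)).
move=> _ [_ [a [b ->] <-]]; rewrite setTI.
by apply: sub_sigma_algebra; move/continuousP : cg; apply; exact: interval_open.
Qed.

Definition bmfun_Cb (g : Cb R S) : bmfun (borel S) R :=
  BMFun (Cb_bounded_measurable g).

Lemma convex_bmfun_Cb (Gamma : set (Cb R S)) :
  convex_set (Gamma : set (convex_lmodType (Cb R S))) ->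
  forall x y (s t : R), (bmfun_Cb @` Gamma) x -> (bmfun_Cb @` Gamma) y ->
    0 <= s -> 0 <= t -> s + t = 1 -> (bmfun_Cb @` Gamma) (s *: x + t *: y).
Proof.
move=> cG _ _ s t [g Gg <-] [k Gk <-] s0 t0 st.
have s1 : s <= 1 by lra.
exists (s *: g + t *: k).
  have := @cG g k (Itv01 s0 s1) (mem_set Gg) (mem_set Gk).
  have -> : t = 1 - s by lra.
  exact: set_mem.
by apply: bmfunP => x; rewrite bmfunD !bmfunZ.
Qed.

End continuous_test_functions.

Section relative_entropy.
Context (R : realType) (S : ptopologicalType) (gamma nu : probability (borel S) R).

Lemma cumulant_le_relative_entropy (f : bmfun (borel S) R) :
  ((\int[gamma]_x f x - cumulant nu f)%:E <= relative_entropy gamma nu)%E.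
Proof.
rewrite /relative_entropy; case: asboolP => [gn|_]; last by rewrite leey.
exact: cumulant_le_entropy.
Qed.

Lemma relative_entropy_le (c : R) : gamma `<< nu ->
  (forall f : bmfun (borel S) R, \int[gamma]_x f x + c <= cumulant nu f) ->
  (relative_entropy gamma nu <= (- c)%:E)%E.
Proof.
by move=> gn fc; rewrite /relative_entropy asboolT//; exact: entropy_le.
Qed.

End relative_entropy.

Local Open Scope ereal_scope.

Theorem theorem2p4 (R : realType) (S : ptopologicalType) (hS : polish R S)
    (Gamma : set (Cb R S)) (hGamma : admissible Gamma)
    (mu : {charge set (borel S) -> \bar R}) (nu : probability (borel S) R) :
  Gamma_divergence Gamma mu nu =
  ereal_inf [set relative_entropy gamma nu + W_Gamma Gamma (charge_sub mu gamma)
            | gamma in [set: probability (borel S) R]].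
Proof.
apply/le_anti/andP; split.
  apply: le_ereal_inf_tmp => _ [gamma _ <-]; apply: ge_ereal_sup => _ [g Gg <-].
  pose f := bmfun_Cb g.
  rewrite -[X in X <= _]/((charge_integral mu f - cumulant nu f)%:E).
  have -> : (charge_integral mu f - cumulant nu f =
      (\int[gamma]_x f x - cumulant nu f) +
      charge_integral (charge_sub mu gamma) f)%R.
    by rewrite charge_integral_sub; ring.
  rewrite EFinD; apply: leeD; first exact: cumulant_le_relative_entropy.
  by apply: ereal_sup_ubound; exists g.
have [cG _ _ cstG _] := hGamma.
pose l : {scalar bmfun (borel S) R} := charge_functional mu.
have divub g : Gamma g ->
    (l (bmfun_Cb g) - cumulant nu (bmfun_Cb g))%:E <= Gamma_divergence Gamma mu nu.
  by move=> Gg; apply: ereal_sup_ubound; exists g.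
case divE : (Gamma_divergence Gamma mu nu) => [m| |]; last 2 first.
- by rewrite leey.
- by have := divub _ (cstG 0%R); rewrite divE.
have A0 : (@bmfun_Cb R S) @` Gamma !=set0.
  by exists (bmfun_Cb (Cb_cst S 0%R)), (Cb_cst S 0%R).
have lm f : ((@bmfun_Cb R S) @` Gamma) f -> (l f - m <= cumulant nu f)%R.
  by move=> [g Gg <-]; have := divub _ Gg; rewrite divE lee_fin; lra.
have [L [c [Lnu lL]]] :=
  convex_sandwich A0 (convex_bmfun_Cb cG) (@cumulant_convex _ _ _ nu) lm.
have [gamma gn gammaL] := cumulant_minorant_integral Lnu.
apply: ge_ereal_inf; exists (relative_entropy gamma nu +
    W_Gamma Gamma (charge_sub mu gamma)); first by exists gamma.
rewrite (_ : m = - c + (m + c))%R; last by ring.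
rewrite EFinD; apply: leeD.
  by apply: relative_entropy_le => // f; rewrite gammaL.
apply: ge_ereal_sup => _ [g Gg <-].
rewrite -[X in X <= _]/((charge_integral (charge_sub mu gamma) (bmfun_Cb g))%:E).
rewrite charge_integral_sub gammaL lee_fin.
have := lL (bmfun_Cb g); rewrite -[l _]/(charge_integral mu (bmfun_Cb g)).
by move=> /(_ (ex_intro2 _ _ g Gg erefl)); lra.
Qed.
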